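(* For every dimension $d$ there exists a constant $c=c(d)$ such that for every function $f\in \mathrm{BMO}(\mathbb{R}^d)$ and every Lebesgue-measure-preserving bi-Lipschitz homeomorphism $\phi$ of $\mathbb{R}^d$, $$\|f\circ\phi\|_{\mathrm{BMO}}\le\|f\|_{\mathrm{BMO}}\left[1+c\log(K_\phi)\right],$$ where $$K_\phi:=\sup_{x\ne y}\max\left(\frac{|\phi(x)-\phi(y)|}{|x-y|},\frac{|x-y|}{|\phi(x)-\phi(y)|}\right).$$
   Context: $\mathrm{BMO}(\mathbb{R}^d)$ is the space of functions of bounded mean oscillation, equipped with the $L^2$-oscillation (semi)norm $$\|f\|_{\mathrm{BMO}}=\sup_B\left(\frac1{|B|}\int_B\left|f(x)-\mathrm{Avg}_Bf\right|^2dx\right)^{1/2},\qquad \mathrm{Avg}_Bf=\frac1{|B|}\int_Bf,$$ the supremum being over all balls $B\subset\mathbb{R}^d$. *)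

(* Defs.v *)
From HB Require Import structures.
From mathcomp Require Import all_boot all_order all_algebra.
From mathcomp Require Import all_classical all_reals all_analysis.

Set Implicit Arguments.
Unset Strict Implicit.
Unset Printing Implicit Defensive.

Import Order.TTheory GRing.Theory Num.Theory.
Import numFieldNormedType.Exports.

Local Open Scope classical_set_scope.
Local Open Scope ring_scope.

(* The library puts no measurable structure on row vectors. We take the
   sigma-algebra generated by the coordinates, i.e. the Borel sets of R^d. *)
Definition measure_rV_display : measure_display.
Proof. exact: default_measure_display. Qed.

Section measurable_rV.
Context {R : realType}.
Variable d : nat.

Let coord : 'I_d -> 'rV[R]_d -> R := fun i x => x ord0 i.

Let rV_set0 : g_sigma_preimage coord set0.
Proof. exact: sigma_algebra0. Qed.

Let rV_setC A : g_sigma_preimage coord A -> g_sigma_preimage coord (~` A).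
Proof. exact: sigma_algebraC. Qed.

Let rV_bigcup (F : (set 'rV[R]_d)^nat) :
  (forall i, g_sigma_preimage coord (F i)) ->
  g_sigma_preimage coord (\bigcup_i (F i)).
Proof. exact: sigma_algebra_bigcup. Qed.

HB.instance Definition _ := @isMeasurable.Build measure_rV_display
  'rV[R]_d (g_sigma_preimage coord) rV_set0 rV_setC rV_bigcup.

End measurable_rV.

Lemma measurable_coord (R : realType) (d : nat) (i : 'I_d) :
  measurable_fun [set: 'rV[R]_d] (fun x : 'rV[R]_d => x ord0 i).
Proof.
move=> _ Y mY; rewrite setTI; apply: sub_sigma_algebra => /=.
rewrite -bigcup_seq/=; exists i => /=; first by rewrite mem_index_enum.
by exists Y => //; rewrite setTI.
Qed.

Lemma measurable_fun_rV (R : realType) (d : nat) (dT : measure_display)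
    (T : measurableType dT) (f : T -> 'rV[R]_d) :
  (forall i, measurable_fun [set: T] (fun x => f x ord0 i)) ->
  measurable_fun [set: T] f.
Proof.
move=> mf _ A mA; rewrite setTI; move: A mA.
suff : (@measurable _ 'rV[R]_d) `<=` [set A | measurable (f @^-1` A)] by exact.
apply: smallest_sub => /=.
- split => [|B|F] /=; first by rewrite preimage_set0.
  + by rewrite setTD preimage_setC => /measurableC.
  + by move=> mF; rewrite preimage_bigcup; exact: bigcup_measurable.
- rewrite -bigcup_seq/= => B -[i _] [C mC <-]/=.
  by rewrite setTI -[X in measurable X]setTI; exact: mf.
Qed.

Definition rV_cons {R : realType} {d : nat} (p : R * 'rV[R]_d) : 'rV[R]_d.+1 :=
  row_mx p.1%:M p.2.

Definition rV_uncons {R : realType} {d : nat} (x : 'rV[R]_d.+1) :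
    R * 'rV[R]_d :=
  (x ord0 ord0, rsubmx (x : 'rV[R]_(1 + d))).

Lemma rV_consK (R : realType) (d : nat) : cancel (@rV_cons R d) rV_uncons.
Proof.
case=> a x; rewrite /rV_uncons /rV_cons/= row_mxKr.
have -> : ord0 = lshift d ord0 :> 'I_(1 + d) by exact/val_inj.
by rewrite (@row_mxEl _ _ 1 d) mxE eqxx mulr1n.
Qed.

Lemma rV_unconsK (R : realType) (d : nat) : cancel (@rV_uncons R d) rV_cons.
Proof.
move=> x; rewrite /rV_uncons /rV_cons/= -[RHS](@hsubmxK _ 1 1 d).
rewrite (_ : _%:M = lsubmx (x : 'rV[R]_(1 + d)))//.
apply/rowP => i; rewrite !mxE !ord1 eqxx mulr1n.
by congr (x _ _); exact/val_inj.
Qed.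

Lemma measurable_rV_cons (R : realType) (d : nat) :
  measurable_fun [set: R * 'rV[R]_d] (@rV_cons R d).
Proof.
apply: measurable_fun_rV => i; case: (unliftP ord0 i) => [j ->|->].
  rewrite (_ : (fun _ => _) = (fun x : 'rV[R]_d => x ord0 j) \o snd).
    by apply: measurableT_comp => //; exact: measurable_coord.
  apply/funext => p /=; rewrite /rV_cons.
  have -> : lift ord0 j = rshift 1 j :> 'I_(1 + d) by exact/val_inj.
  by rewrite (@row_mxEr _ _ 1 d).
rewrite (_ : (fun _ => _) = fst); first exact: measurable_fst.
by apply/funext => p; rewrite -[in RHS](rV_consK p).
Qed.

Lemma measurable_rV_uncons (R : realType) (d : nat) :
  measurable_fun [set: 'rV[R]_d.+1] (@rV_uncons R d).
Proof.
apply/measurable_fun_pairP; split; first exact: measurable_coord.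
apply: measurable_fun_rV => i.
rewrite (_ : (fun _ => _) = fun x : 'rV[R]_d.+1 => x ord0 (lift ord0 i)).
  exact: measurable_coord.
apply/funext => x /=; rewrite !mxE; congr (x _ _); exact/val_inj.
Qed.

Section rV_cons_measure.
Context {R : realType} {d : nat}.
Variable m : {sigma_finite_measure set 'rV[R]_d -> \bar R}.

Definition rV_cons_measure : set 'rV[R]_d.+1 -> \bar R :=
  pushforward (@lebesgue_measure R \x m)%E rV_cons.

Let mcons (B : set 'rV[R]_d.+1) :
  measurable B -> measurable (@rV_cons R d @^-1` B).
Proof.
by move=> mB; rewrite -[X in measurable X]setTI; exact: measurable_rV_cons.
Qed.

Let rV_cons_measure0 : rV_cons_measure set0 = 0%E.
Proof. by rewrite /rV_cons_measure /pushforward preimage_set0 measure0. Qed.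

Let rV_cons_measure_ge0 A : (0 <= rV_cons_measure A)%E.
Proof. by rewrite /rV_cons_measure /pushforward measure_ge0. Qed.

Let rV_cons_measure_sigma_additive : semi_sigma_additive rV_cons_measure.
Proof.
move=> F mF tF mUF; rewrite /rV_cons_measure /pushforward preimage_bigcup.
apply: measure_semi_sigma_additive.
- by move=> n; exact: mcons.
- apply/trivIsetP => /= i j _ _ ij; rewrite -preimage_setI.
  by move/trivIsetP : tF => /(_ _ _ _ _ ij) ->//; rewrite preimage_set0.
- by rewrite -preimage_bigcup; exact: mcons.
Qed.

HB.instance Definition _ := isMeasure.Build _ _ _ rV_cons_measure
  rV_cons_measure0 rV_cons_measure_ge0 rV_cons_measure_sigma_additive.

Let rV_cons_measure_sigma_finite : sigma_finite setT rV_cons_measure.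
Proof.
have [F TF mF] : sigma_finite setT (@lebesgue_measure R \x m)%E.
  have /sigma_finiteP[F [TF ndF Foo]] := sigma_finiteT (@lebesgue_measure R).
  have /sigma_finiteP[G [TG ndG Goo]] := sigma_finiteT m.
  exists (fun n => F n `*` G n).
    rewrite -setXTT TF TG predeqE => -[x y]; split.
      move=> [/= [n _ Fnx] [k _ Gky]]; exists (maxn n k) => //; split.
      - by move: x Fnx; exact/subsetPset/ndF/leq_maxl.
      - by move: y Gky; exact/subsetPset/ndG/leq_maxr.
    by move=> [n _ []/= ? ?]; split; exists n.
  move=> k; have [? ?] := Foo k; have [? ?] := Goo k.
  split; first exact: measurableX.
  by rewrite product_measure1E// lte_mul_pinfty// ge0_fin_numE.
exists (fun n => rV_uncons @^-1` F n).
  by rewrite -preimage_bigcup -TF preimage_setT.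
move=> n; have [mFn Fnoo] := mF n; split.
  by rewrite -[X in measurable X]setTI; exact: measurable_rV_uncons.
rewrite /rV_cons_measure /pushforward -comp_preimage.
by rewrite (_ : _ \o _ = id) ?preimage_id//; apply/funext => p; exact: rV_consK.
Qed.

HB.instance Definition _ := Measure_isSigmaFinite.Build _ _ _ rV_cons_measure
  rV_cons_measure_sigma_finite.

End rV_cons_measure.

(* The d-fold product of one-dimensional Lebesgue measure, on Borel sets. *)
Fixpoint borel_lebesgue (R : realType) (d : nat) :
    {sigma_finite_measure set 'rV[R]_d -> \bar R} :=
  match d return {sigma_finite_measure set 'rV[R]_d -> \bar R} with
  | 0 => \d_ (0 : 'rV[R]_0)
  | d'.+1 => rV_cons_measure (borel_lebesgue R d')
  end.

(* R^d with its Lebesgue (Caratheodory) sigma-algebra; as a bare type this is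
   'rV[R]_d, and lebesgueRd is a complete measure. *)
Definition lebRd (R : realType) (d : nat) :=
  caratheodory_type (borel_lebesgue R d)^*%mu.
HB.instance Definition _ R d := Measurable.on (lebRd R d).

Definition lebesgueRd (R : realType) (d : nat) : set (lebRd R d) -> \bar R :=
  @completed_measure_extension _ _ _ (borel_lebesgue R d).
HB.instance Definition _ R d := Measure.on (@lebesgueRd R d).

(* Euclidean norm; the library's norm on row vectors is the sup norm. *)
Definition enorm (R : realType) (d : nat) (x : 'rV[R]_d) : R :=
  Num.sqrt (\sum_(i < d) x ord0 i ^+ 2).

Definition eball (R : realType) (d : nat) (x : 'rV[R]_d) (r : R) :
    set (lebRd R d) :=
  [set y : 'rV[R]_d | enorm (y - x) < r].

Section bmo.
Context {R : realType} {d : nat}.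
Implicit Types (f : lebRd R d -> R) (B : set (lebRd R d)).

Local Notation mu := (@lebesgueRd R d).

Definition avg B f : R := (fine (mu B))^-1 * (\int[mu]_(x in B) f x)%R.

Definition oscillation B f : \bar R :=
  sqrte ((fine (mu B))^-1%:E * \int[mu]_(x in B) (`|f x - avg B f| ^+ 2)%:E).

Definition bmo_norm f : \bar R :=
  ereal_sup [set oscillation (eball p.1 p.2) f
            | p in [set p : 'rV[R]_d * R | 0 < p.2]].

(* Local integrability (hence Lebesgue measurability) makes the averages in
   the seminorm meaningful. *)
Definition BMO f : Prop :=
  (forall (x : 'rV[R]_d) (r : R), 0 < r ->
     mu.-integrable (eball x r) (EFin \o f)) /\
  (bmo_norm f < +oo)%E.

End bmo.

Section transformations.
Context {R : realType} {d : nat}.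
Implicit Types phi : 'rV[R]_d -> 'rV[R]_d.

Definition homeomorphism phi : Prop :=
  continuous phi /\
  exists psi : 'rV[R]_d -> 'rV[R]_d,
    [/\ continuous psi, cancel phi psi & cancel psi phi].

Definition bilipschitz phi : Prop :=
  exists2 L : R, 0 < L & forall x y : 'rV[R]_d,
    L^-1 * enorm (x - y) <= enorm (phi x - phi y) <= L * enorm (x - y).

Definition measure_preserving phi : Prop :=
  measurable_fun [set: lebRd R d] (phi : lebRd R d -> lebRd R d) /\
  forall A : set (lebRd R d), measurable A ->
    @lebesgueRd R d (phi @^-1` A) = lebesgueRd A.

(* A real supremum: [sup] is meaningful here only because the set is bounded
   when phi is bi-Lipschitz. *)
Definition bilip_const phi : R :=
  sup [set Num.max (enorm (phi p.1 - phi p.2) / enorm (p.1 - p.2))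
                   (enorm (p.1 - p.2) / enorm (phi p.1 - phi p.2))
      | p in [set p : 'rV[R]_d * 'rV[R]_d | p.1 != p.2]].

End transformations.

(* Main.v *)
Require Import Defs.
From mathcomp Require Import all_boot all_order all_algebra.
From mathcomp Require Import all_classical all_reals all_analysis.
From mathcomp Require Import measurable_realfun ring lra.
Set Implicit Arguments.
Unset Strict Implicit.
Unset Printing Implicit Defensive.
Import Order.TTheory GRing.Theory Num.Theory.
Import numFieldNormedType.Exports.
Local Open Scope classical_set_scope.
Local Open Scope ring_scope.

(* Let B = B(x, r), N = ||f||_BMO and K = K_phi. Since phi preserves measure, it
   suffices to bound the integral of |f - a|^2 over phi(B) for some constant a.

   For K < 2, phi(B) lies in B(phi x, K r), whose volume is K^d |B|; with a the
   average over that ball the oscillation is at most K^(d/2) N, and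
   K^(d/2) <= K^d <= 1 + c log K.

   For K >= 2, John-Nirenberg is avoided by using the bi-Lipschitz bound in both
   directions. Let M = 2^m >= K with m of order log K, and choose a maximal
   2r/M-separated subset of phi(B). The balls of radius 2r/M about its points
   cover phi(B); the concentric balls of radius r/M are disjoint with preimages in
   B(x, 2r), so the total volume of the cover is at most 4^d |B|. Doubling the
   radius 2m times reaches a ball containing B(phi x, M r), so on each ball of the
   cover the average of f is within (2m + 1) 2^d N of its average over
   B(phi x, M r). *)

(** * Lebesgue measure under dilations and translations *)

Local Notation measure_pushforward :=
  measure_function_pushforward__canonical__measure_function_Measure.

Lemma measurable_affine (R : realType) (z s : R) :
  measurable_fun [set: R] (fun t : R => z + s * t).
Proof. by apply: measurable_funD => //; exact: measurable_funM. Qed.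

(** Both sides are measures in [A]. They agree on half-open intervals, which determine Lebesgue
    measure. *)
Lemma lebesgue_measure_affine (R : realType) (z s : R) (A : set R) :
  0 < s -> measurable A ->
  lebesgue_measure A
  = (s%:E * lebesgue_measure ((fun t : R => z + s * t)%R @^-1` A))%E.
Proof.
move=> s0 mA.
pose f (t : measurableTypeR R) : measurableTypeR R := z + s * t.
pose m' : {measure set (measurableTypeR R) -> \bar R} :=
  mscale (NngNum (ltW s0)) (measure_pushforward (@lebesgue_measure R)
    (measurable_affine z s : measurable_fun _ f)).
rewrite -[RHS]/(m' A); apply: lebesgue_measure_unique => // _ [[a b] _ <-].
change (lebesgue_measure `]a, b]%classic
  = s%:E * lebesgue_measure (f @^-1` `]a, b]%classic))%E.
have -> : f @^-1` `]a, b]%classic = `](a - z) / s, (b - z) / s]%classic :> set R.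
  apply/seteqP; split => t /=; rewrite !in_itv/= ltr_pdivrMr// ler_pdivlMr//;
  by rewrite ltrBlDl lerBrDl (mulrC t).
rewrite !lebesgue_measure_itv/= !lte_fin ltr_pM2r ?invr_gt0// ltrD2r.
case: ifPn => ab; last by rewrite mule0.
by rewrite -!EFinB -EFinM; congr EFin; field; rewrite gt_eqF.
Qed.

Section affine_rV.
Context {R : realType}.

Definition rV_affine {d} (z : 'rV[R]_d) (s : R) (x : 'rV[R]_d) : 'rV[R]_d :=
  z + s *: x.

Lemma rV_cons0 d (p : R * 'rV[R]_d) : rV_cons p ord0 ord0 = p.1.
Proof. by rewrite -[in RHS](rV_consK p). Qed.

Lemma rV_consS d (p : R * 'rV[R]_d) (j : 'I_d) :
  rV_cons p ord0 (lift ord0 j) = p.2 ord0 j.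
Proof.
rewrite /rV_cons; have -> : lift ord0 j = rshift 1 j :> 'I_(1 + d) by exact/val_inj.
by rewrite (@row_mxEr _ _ 1 d).
Qed.

Lemma measurable_rV_affine d (z : 'rV[R]_d) (s : R) :
  measurable_fun [set: 'rV[R]_d] (rV_affine z s).
Proof.
apply: measurable_fun_rV => i.
under eq_fun do rewrite !mxE.
by apply: measurable_funD => //; apply: measurable_funM => //; exact: measurable_coord.
Qed.

(** Induction on [d]: the affine map acts separately on the first coordinate and on the rest, so the
    rescaled pushforward [m'] agrees with the product measure on rectangles, and uniqueness of the
    product measure applies. *)
Lemma borel_lebesgue_affine d (z : 'rV[R]_d) (s : R) (A : set 'rV[R]_d) :
  0 < s -> measurable A ->
  borel_lebesgue R d A = ((s ^+ d)%:E * borel_lebesgue R d (rV_affine z s @^-1` A))%E.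
Proof.
move=> s0; elim: d z A => [|d IH] z A mA.
  rewrite expr0 mul1e /= !diracE; congr (_ %:R%:E); congr nat_of_bool.
  by apply/idP/idP; rewrite !inE /= (thinmx0 (rV_affine _ _ _)).
rewrite /= /rV_cons_measure /pushforward.
have mcons (B : set 'rV[R]_d.+1) : measurable B -> measurable (@rV_cons R d @^-1` B).
  by move=> mB; rewrite -[X in measurable X]setTI; exact: measurable_rV_cons.
pose T (p : measurableTypeR R * 'rV[R]_d) : measurableTypeR R * 'rV[R]_d :=
  (z ord0 ord0 + s * p.1, rV_affine (rsubmx (z : 'rV_(1 + d))) s p.2).
have mT : measurable_fun setT T.
  apply/measurable_fun_pairP; split; rewrite /T/=.
    apply: (measurableT_comp (measurable_affine (z ord0 ord0) s)).
    exact: measurable_fst.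
  by apply: (measurableT_comp (measurable_rV_affine _ _)); exact: measurable_snd.
pose m' : {measure set (measurableTypeR R * 'rV[R]_d)%type -> \bar R} :=
  mscale (NngNum (exprn_ge0 d.+1 (ltW s0)))
    (measure_pushforward (@lebesgue_measure R \x borel_lebesgue R d)%E mT).
rewrite (@product_measure_unique _ _ _ _ _ _ _ m').
- rewrite /m'/= /mscale /= /pushforward; congr (_ * _)%E.
  suff consT p : rV_cons (T p) = rV_affine z s (rV_cons p).
    congr ((_ \x _)%E _).
    by apply/seteqP; split => p /=; rewrite consT.
  apply/rowP => i; case: (unliftP ord0 i) => [j ->|->].
    rewrite rV_consS [in RHS]mxE [in X in _ = _ + X]mxE rV_consS !mxE.
    by congr (z _ _ + _); exact/val_inj.
  by rewrite rV_cons0 [in RHS]mxE [in X in _ = _ + X]mxE rV_cons0.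
- move=> B C mB mC; rewrite [LHS]/(m' _)/= /mscale/= /pushforward/=.
  have -> : T @^-1` (B `*` C) = ((fun t : R => z ord0 ord0 + s * t) @^-1` B) `*`
     (rV_affine (rsubmx (z : 'rV_(1 + d))) s @^-1` C) by [].
  rewrite product_measure1E.
  + rewrite (lebesgue_measure_affine (z ord0 ord0) s0 mB).
    rewrite (IH (rsubmx (z : 'rV_(1 + d))) C mC) exprS EFinM.
    by rewrite !muleA; congr (_ * _)%E; rewrite muleAC.
  + rewrite -[X in measurable X]setTI; exact: measurable_affine.
  + rewrite -[X in measurable X]setTI; exact: measurable_rV_affine.
- exact: mcons.
Qed.
End affine_rV.

(** * The Euclidean norm: Cauchy-Schwarz and the triangle inequality *)

Section euclidean_norm.
Context {R : realType} {d : nat}.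
Implicit Types x y z : 'rV[R]_d.

Lemma enorm_ge0 x : 0 <= enorm x.
Proof. exact: sqrtr_ge0. Qed.

Lemma sum_sqr_ge0 x : 0 <= \sum_(i < d) x ord0 i ^+ 2.
Proof. by apply: sumr_ge0 => i _; exact: sqr_ge0. Qed.

Lemma sqr_enorm x : enorm x ^+ 2 = \sum_(i < d) x ord0 i ^+ 2.
Proof. by rewrite sqr_sqrtr// sum_sqr_ge0. Qed.

Lemma enormZ (s : R) x : 0 <= s -> enorm (s *: x) = s * enorm x.
Proof.
move=> s0; rewrite /enorm -[in RHS](ger0_norm s0) -sqrtr_sqr -sqrtrM ?sqr_ge0//.
by rewrite mulr_sumr; congr Num.sqrt; apply: eq_bigr => i _; rewrite mxE exprMn.
Qed.

Lemma enormN x : enorm (- x) = enorm x.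
Proof. by congr Num.sqrt; apply: eq_bigr => i _; rewrite mxE sqrrN. Qed.

Lemma enorm_distC x y : enorm (x - y) = enorm (y - x).
Proof. by rewrite -enormN opprB. Qed.

Lemma enorm0 : enorm (0 : 'rV[R]_d) = 0.
Proof. by rewrite -(scale0r (0 : 'rV[R]_d)) enormZ// mul0r. Qed.

Lemma enorm0_eq0 x : enorm x = 0 -> x = 0.
Proof.
move=> x0; have := sqr_enorm x; rewrite x0 expr0n => /esym/eqP.
rewrite psumr_eq0 => [/allP x00|i _]; last exact: sqr_ge0.
apply/rowP => i; rewrite mxE; apply/eqP; rewrite -sqrf_eq0.
by have := x00 i; rewrite mem_index_enum; apply.
Qed.

(** With [a] and [b] the two norms, expanding the nonnegative sum of the squares of b x_i - a y_i
    and dividing by 2ab gives the bound; a vanishing norm is treated apart. *)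
Lemma cauchy_schwarz x y :
  \sum_(i < d) x ord0 i * y ord0 i <= enorm x * enorm y.
Proof.
set a := enorm x; set b := enorm y.
have [a0|a0] := eqVneq a 0.
  rewrite a0 mul0r big1// => i _.
  by rewrite (enorm0_eq0 a0) mxE mul0r.
have [b0|b0] := eqVneq b 0.
  rewrite b0 mulr0 big1// => i _.
  by rewrite (enorm0_eq0 b0) mxE mulr0.
have ab : 0 < a * b by rewrite mulr_gt0// lt_neqAle eq_sym ?a0 ?b0 enorm_ge0.
have : 0 <= \sum_(i < d) (b * x ord0 i - a * y ord0 i) ^+ 2.
  by apply: sumr_ge0 => i _; exact: sqr_ge0.
rewrite (eq_bigr (fun i => b ^+ 2 * x ord0 i ^+ 2
    + (- (2 * (a * b)) * (x ord0 i * y ord0 i) + a ^+ 2 * y ord0 i ^+ 2))).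
  rewrite !big_split/= -!mulr_sumr -!sqr_enorm -/a -/b => ab_ge0.
  by rewrite -(ler_pM2l ab); nra.
by move=> i _; ring.
Qed.

Lemma enormD x y : enorm (x + y) <= enorm x + enorm y.
Proof.
rewrite -(ler_pXn2r (n := 2))// ?nnegrE ?addr_ge0 ?enorm_ge0//.
rewrite sqr_enorm (eq_bigr (fun i => x ord0 i ^+ 2
    + (2 * (x ord0 i * y ord0 i) + y ord0 i ^+ 2))).
  rewrite !big_split/= -!mulr_sumr -!sqr_enorm.
  by have := cauchy_schwarz x y; nra.
by move=> i _; rewrite mxE; ring.
Qed.

Lemma enorm_triangle z x y : enorm (x - y) <= enorm (x - z) + enorm (z - y).
Proof. by rewrite (le_trans _ (enormD _ _))// addrA subrK. Qed.

Lemma ler_enorm_coord x i : `|x ord0 i| <= enorm x.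
Proof.
rewrite -(ler_pXn2r (n := 2))// ?nnegrE ?enorm_ge0//.
rewrite sqr_enorm real_normK ?num_real// (bigD1 i)//= lerDl.
by apply: sumr_ge0 => j _; exact: sqr_ge0.
Qed.

End euclidean_norm.

(** * Inclusion, measurability and scaling of Euclidean balls *)

Section balls.
Context {R : realType} {d : nat}.
Implicit Types x y z : 'rV[R]_d.

Lemma sub_eball x y (r s : R) : enorm (x - y) + r <= s -> eball x r `<=` eball y s.
Proof.
move=> xyrs z; rewrite /eball/= => zx.
rewrite (le_lt_trans (enorm_triangle x _ _))// (lt_le_trans _ xyrs)//.
by rewrite addrC ltrD2l.
Qed.

Lemma borel_measurable_eball x (r : R) :
  measurable (eball x r : set 'rV[R]_d).
Proof.
have [r0|r0] := leP r 0.
  rewrite (_ : eball x r = set0)//; apply/seteqP; split => // y.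
  by rewrite /eball/= ltNge (le_trans r0)// enorm_ge0.
pose g (y : 'rV[R]_d) : R := \sum_(i < d) (y ord0 i - x ord0 i) ^+ 2.
have mg : measurable_fun setT g.
  apply: measurable_sum => i; apply: measurable_funX.
  by apply: measurable_funB => //; exact: measurable_coord.
have -> : eball x r = g @^-1` `]-oo, r ^+ 2[.
  have E y : (enorm (y - x) < r) = (g y < r ^+ 2).
    rewrite -(ltr_pXn2r (n := 2))// ?nnegrE ?enorm_ge0 ?(ltW r0)// sqr_enorm.
    by under eq_bigr do rewrite !mxE.
  by apply/seteqP; split => y; rewrite /eball/= in_itv/= E.
by rewrite -[X in measurable X]setTI; exact: mg.
Qed.

Lemma lebRd_measurable (A : set 'rV[R]_d) :
  measurable A -> measurable (A : set (lebRd R d)).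
Proof. exact: caratheodory_measurable_mu_ext. Qed.

Lemma lebesgueRdE (A : set 'rV[R]_d) :
  measurable A -> lebesgueRd A = borel_lebesgue R d A.
Proof. exact: measurable_mu_extE. Qed.

Lemma measurable_eball x (r : R) : measurable (eball x r).
Proof. by apply: lebRd_measurable; exact: borel_measurable_eball. Qed.

(** Balls are Borel, so the computation takes place under [borel_lebesgue], where the map y -> x + r
    y pulls the ball back to the unit ball. *)
Lemma lebesgueRd_eball_scale x (r : R) : 0 < r ->
  lebesgueRd (eball x r) = ((r ^+ d)%:E * lebesgueRd (eball (0 : 'rV[R]_d) 1))%E.
Proof.
move=> r0; rewrite !lebesgueRdE; try exact: borel_measurable_eball.
rewrite (borel_lebesgue_affine x r0); last exact: borel_measurable_eball.
congr (_ * borel_lebesgue R d _)%E.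
apply/seteqP; split => y; rewrite /eball/= /rV_affine addrAC subrr add0r subr0;
by rewrite enormZ ?(ltW r0)// -{2}(mulr1 r) ltr_pM2l.
Qed.

End balls.

(** * The volume of a ball is positive and finite *)

Section ball_measure.
Context {R : realType}.

Definition cube (d : nat) (a : R) : set 'rV[R]_d :=
  [set x | forall i, x ord0 i \in `]- a, a[].

Lemma cubeS d (a : R) :
  @rV_cons R d @^-1` @cube d.+1 a = `]- a, a[%classic `*` @cube d a.
Proof.
apply/seteqP; split => [p pa|p [p1 p2] i].
  split; first by have := pa ord0; rewrite rV_cons0.
  by move=> i; have := pa (lift ord0 i); rewrite rV_consS.
case: (unliftP ord0 i) => [j ->|->]; last by rewrite rV_cons0.
by rewrite rV_consS; exact: p2.
Qed.

Lemma measurable_cube d (a : R) : measurable (@cube d a).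
Proof.
rewrite (_ : @cube d a
    = \bigcap_(i in [set: 'I_d]) ((fun x => x ord0 i) @^-1` `]- a, a[)).
  apply: fin_bigcap_measurable => // i _.
  by rewrite -[X in measurable X]setTI; exact: measurable_coord.
by apply/seteqP; split => [x xa i _|x xa i]; [exact: xa|exact: (xa i I)].
Qed.

Lemma borel_lebesgue_cube d (a : R) : 0 < a ->
  borel_lebesgue R d (@cube d a) = ((a *+ 2) ^+ d)%:E.
Proof.
move=> a0; elim: d => [|d IH].
  by rewrite expr0 /= diracE mem_set// => -[].
pose I : set (measurableTypeR R) := `]- a, a[%classic.
transitivity ((@lebesgue_measure R \x borel_lebesgue R d) (I `*` @cube d a))%E.
  by rewrite /I -cubeS.
rewrite product_measure1E; [|exact: measurable_itv|exact: measurable_cube].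
rewrite IH exprS EFinM; congr (_ * _)%E.
by rewrite [LHS]lebesgue_measure_itv/= lte_fin gtrN// -EFinB opprK.
Qed.

(** The unit ball lies between two cubes centred at 0, whose volumes are explicit. *)
Lemma lebesgueRd_unit_ball d :
  exists2 c : R, 0 < c & lebesgueRd (eball (0 : 'rV[R]_d) 1) = c%:E.
Proof.
have mb := borel_measurable_eball (0 : 'rV[R]_d) 1.
(* A point of the cube has squared norm at most d / (d+1)^2, which is below 1 also when [d] is 0. *)
pose a : R := d.+1%:R^-1.
have a0 : 0 < a by rewrite invr_gt0.
have lo : (((a *+ 2) ^+ d)%R%:E <= lebesgueRd (eball (0 : 'rV[R]_d) 1))%E.
  rewrite lebesgueRdE// -borel_lebesgue_cube//; apply: le_measure;
    rewrite ?inE//; first exact: measurable_cube.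
  move=> x xa; rewrite /eball/= subr0 -(ltr_pXn2r (n := 2))// ?nnegrE ?enorm_ge0//.
  rewrite sqr_enorm expr1n (@le_lt_trans _ _ (\sum_(i < d) a ^+ 2))//.
    apply: ler_sum => i _; have := xa i; rewrite in_itv/= => /andP[? ?]; nra.
  rewrite sumr_const card_ord -mulr_natl /a expr2 mulrA.
  have d1 : (d%:R : R) < d.+1%:R by rewrite ltr_nat.
  have d10 : (0 : R) < d.+1%:R by rewrite ltr0n.
  have d12 : (1 : R) <= d.+1%:R by rewrite ler1n.
  rewrite ltr_pdivrMr// mul1r ltr_pdivrMr//; nra.
have hi : (lebesgueRd (eball (0 : 'rV[R]_d) 1) <= ((1 *+ 2) ^+ d)%R%:E)%E.
  rewrite lebesgueRdE// -borel_lebesgue_cube//; apply: le_measure;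
    rewrite ?inE//; first exact: measurable_cube.
  move=> x; rewrite /eball/= subr0 => x1 i; rewrite in_itv/= -ltr_norml.
  exact: le_lt_trans (ler_enorm_coord _ _) x1.
have fin : lebesgueRd (eball (0 : 'rV[R]_d) 1) \is a fin_num.
  by rewrite ge0_fin_numE// (le_lt_trans hi)// ltry.
exists (fine (lebesgueRd (eball (0 : 'rV[R]_d) 1))); last by rewrite fineK.
rewrite -lte_fin fineK// (lt_le_trans _ lo)// lte_fin exprn_gt0// pmulrn_lgt0//.
Qed.

Definition ball_volume d (r : R) : R :=
  r ^+ d * fine (lebesgueRd (eball (0 : 'rV[R]_d) 1)).

Lemma ball_volume_gt0 d (r : R) : 0 < r -> 0 < ball_volume d r.
Proof.
move=> r0; have [c c0 E] := lebesgueRd_unit_ball d.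
by rewrite /ball_volume E/= mulr_gt0// exprn_gt0.
Qed.

Lemma ball_volumeM d (s r : R) : ball_volume d (s * r) = s ^+ d * ball_volume d r.
Proof. by rewrite /ball_volume exprMn mulrA. Qed.

Lemma lebesgueRd_eball d (x : 'rV[R]_d) (r : R) : 0 < r ->
  lebesgueRd (eball x r) = (ball_volume d r)%:E.
Proof.
move=> r0; rewrite lebesgueRd_eball_scale// /ball_volume.
by have [c c0 ->] := lebesgueRd_unit_ball d.
Qed.

End ball_measure.

(** * Mean square deviation from a constant on a set of finite measure *)

Section square_deviation.
Context {d : measure_display} {T : measurableType d} {R : realType}.
Variable mu : {measure set T -> \bar R}.
Implicit Types (D : set T) (g : T -> R).

Lemma measurable_sqr_dev D g (a : R) : measurable_fun D g ->
  measurable_fun D (fun x => ((g x - a) ^+ 2)%:E).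
Proof.
move=> mg; apply/measurable_EFinP; apply: measurable_funX.
exact: measurable_funB.
Qed.

Lemma integrable_cst_fin D (a : R) : measurable D -> (mu D < +oo)%E ->
  mu.-integrable D (EFin \o cst a).
Proof.
move=> mD Doo; apply/integrableP; split; first exact/measurable_EFinP.
rewrite (eq_integral (cst `|a|%:E))// integral_cst//.
by rewrite lte_mul_pinfty// lee_fin.
Qed.

(** First powers are dominated through |u| <= 1 + u^2, whose right side is integrable on a set of
    finite measure. *)
Lemma sqr_dev_integrable D g (a : R) : measurable D -> (mu D < +oo)%E ->
  measurable_fun D g -> (\int[mu]_(x in D) ((g x - a) ^+ 2)%:E < +oo)%E ->
  mu.-integrable D (fun x => ((g x - a) ^+ 2)%:E) /\
  mu.-integrable D (EFin \o (fun x => g x - a)).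
Proof.
move=> mD Doo mg goo.
have ig2 : mu.-integrable D (fun x => ((g x - a) ^+ 2)%:E).
  apply/integrableP; split; first exact: measurable_sqr_dev.
  apply: le_lt_trans goo; apply: ge0_le_integral => //.
  - by apply: measurableT_comp => //; exact: measurable_sqr_dev.
  - exact: measurable_sqr_dev.
  - by move=> x _; rewrite abse_EFin lee_fin ger0_norm// sqr_ge0.
split=> //.
apply: (le_integrable mD _ _ (integrableD mD (integrable_cst_fin 1 mD Doo) ig2)).
  by apply/measurable_EFinP; exact: measurable_funB.
move=> x _ /=; rewrite lee_fin [leRHS]ger0_norm ?addr_ge0// ?sqr_ge0//.
have := sqr_ge0 (`|g x - a| - 1); rewrite sqrrB1 real_normK ?num_real//.
have := normr_ge0 (g x - a); lra.
Qed.

(** Pointwise, (g - a)^2 <= 2 (g - b)^2 + 2 (b - a)^2. *)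
Lemma sqr_dev_lty D g (a b : R) : measurable D -> (mu D < +oo)%E ->
  measurable_fun D g -> (\int[mu]_(x in D) ((g x - b) ^+ 2)%:E < +oo)%E ->
  (\int[mu]_(x in D) ((g x - a) ^+ 2)%:E < +oo)%E.
Proof.
move=> mD Doo mg goo.
have [ib2 _] := sqr_dev_integrable mD Doo mg goo.
have /integrableP[_] := integrableD mD (integrableZl mD 2 ib2)
  (integrable_cst_fin (2 * (b - a) ^+ 2) mD Doo).
apply: le_lt_trans; apply: ge0_le_integral => //.
- by move=> x _; rewrite lee_fin sqr_ge0.
- exact: measurable_sqr_dev.
- apply: measurableT_comp => //; apply: emeasurable_funD => //.
    by apply: measurable_funeM; exact: measurable_sqr_dev.
  exact/measurable_EFinP.
- move=> x _ /=; rewrite lee_fin (le_trans _ (ler_norm _))//.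
  by have := sqr_ge0 (g x + a - 2 * b); rewrite !expr2; lra.
Qed.

(** Variance plus squared bias: write (g - m)^2 as (g - a)^2 - 2 t (g - a) + t^2 with t = m - a; the
    integral of g - a is t V, so the last two terms contribute - V t^2. *)
Lemma sqr_dev_mean D g (a V : R) : measurable D -> mu D = V%:E -> 0 < V ->
  measurable_fun D g -> (\int[mu]_(x in D) ((g x - a) ^+ 2)%:E < +oo)%E ->
  let m := V^-1 * \int[mu]_(x in D) g x in
  (\int[mu]_(x in D) ((g x - a) ^+ 2)%:E
   = \int[mu]_(x in D) ((g x - m) ^+ 2)%:E + (V * (m - a) ^+ 2)%:E)%E.
Proof.
move=> mD DV V0 mg goo m.
have Doo : (mu D < +oo)%E by rewrite DV ltry.
have [ih2 ih] := sqr_dev_integrable mD Doo mg goo.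
have ic c := integrable_cst_fin c mD Doo.
pose h x := g x - a; pose t := m - a.
have ig : mu.-integrable D (EFin \o g).
  rewrite (_ : _ \o _ = (EFin \o h) \+ (EFin \o cst a))%E; first exact: integrableD.
  by apply/funext => x /=; rewrite -EFinD subrK.
have it : mu.-integrable D (EFin \o (fun x => 2 * t * h x)).
  rewrite (_ : _ \o _ = fun x => (2 * t)%:E * (EFin \o h) x)%E//.
  exact: integrableZl.
have hE : \int[mu]_(x in D) h x = t * V.
  have -> : \int[mu]_(x in D) h x = \int[mu]_(x in D) g x - a * V.
    by rewrite (RintegralB mD ig (ic a)) Rintegral_cst// DV.
  by rewrite /t /m; field; rewrite gt_eqF.
have iq : mu.-integrable D (EFin \o (fun x => (g x - a) ^+ 2 - 2 * t * h x)).
  exact: (integrableB mD ih2 it).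
have im : mu.-integrable D (EFin \o (fun x => (g x - m) ^+ 2)).
  rewrite (_ : _ \o _ = (EFin \o (fun x => ((g x - a) ^+ 2 - 2 * t * h x)%R))
      \+ (EFin \o cst (t ^+ 2)%R))%E; first exact: integrableD.
  by apply/funext => x /=; rewrite -EFinD; congr EFin; rewrite /h /t; ring.
rewrite -[LHS]fineK ?integrable_fin_num// -[X in (X + _)%E]fineK ?integrable_fin_num//.
rewrite -EFinD; congr EFin.
rewrite -!/(Rintegral _ _ _).
have -> : \int[mu]_(x in D) ((g x - m) ^+ 2) =
    \int[mu]_(x in D) (((g x - a) ^+ 2 - 2 * t * h x) + cst (t ^+ 2) x).
  by apply: eq_Rintegral => x _; rewrite /h /t/=; ring.
rewrite RintegralD// RintegralB// RintegralZl// Rintegral_cst// DV/= hE.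
by rewrite /t; ring.
Qed.

Lemma sqr_dev_mean_le D g (a V : R) : measurable D -> mu D = V%:E -> 0 < V ->
  measurable_fun D g ->
  (\int[mu]_(x in D) ((g x - (V^-1 * \int[mu]_(x in D) g x)%R) ^+ 2)%:E
   <= \int[mu]_(x in D) ((g x - a) ^+ 2)%:E)%E.
Proof.
move=> mD DV V0 mg.
have [goo|] := ltP (\int[mu]_(x in D) ((g x - a) ^+ 2)%:E)%E +oo%E; last first.
  by rewrite leye_eq => /eqP ->; rewrite leey.
rewrite [leRHS](sqr_dev_mean mD DV V0 mg goo) leeDl// lee_fin mulr_ge0//.
  exact: ltW.
exact: sqr_ge0.
Qed.

End square_deviation.

(** * Finite covers and finite disjoint families *)

Section finite_cover.
Context {d : measure_display} {T : measurableType d} {R : realType}.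
Variable mu : {measure set T -> \bar R}.

(** Induction on the cover: the part of [D] inside the first set is charged to that set, and the
    remaining sets cover the difference. *)
Lemma ge0_integral_cover_le (I : eqType) (s : seq I) (F : I -> set T) (D : set T)
    (h : T -> \bar R) :
  measurable D -> (forall i, measurable (F i)) ->
  (forall i, i \in s -> measurable_fun (F i) h) -> (forall x, 0 <= h x)%E ->
  measurable_fun D h ->
  (forall x, D x -> exists2 i, i \in s & F i x) ->
  (\int[mu]_(x in D) h x <= \sum_(i <- s) \int[mu]_(x in F i) h x)%E.
Proof.
move=> + mF; elim: s D => [|i s IH] D mD mh h0 mhD DF.
  by rewrite (_ : D = set0) ?integral_set0 ?big_nil//; apply/seteqP; split => // x /DF[].
have mDF : measurable (D `&` F i) by exact: measurableI.
have mDD : measurable (D `\` F i) by exact: measurableD.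
rewrite big_cons -(setUIDK D (F i)) ge0_integral_setU//.
- apply: leeD.
    by apply: ge0_subset_integral => //; apply: mh; rewrite mem_head.
  apply: IH => //.
  + by move=> j js; apply: mh; rewrite inE js orbT.
  + by apply: measurable_funS mhD => //; exact: subDsetl.
  + move=> x [Dx nFx]; have [j] := DF x Dx; rewrite inE => /orP[/eqP ->//|js Fx].
    by exists j.
- by rewrite setUIDK.
- by rewrite disj_set2E setDE setIACA setICr setI0.
Qed.

Lemma measure_disjoint_sum_le (I : eqType) (s : seq I) (F : I -> set T) (D : set T) :
  measurable D -> (forall i, measurable (F i)) -> uniq s ->
  (forall i j x, i \in s -> j \in s -> F i x -> F j x -> i = j) ->
  (forall i, i \in s -> F i `<=` D) ->
  (\sum_(i <- s) mu (F i) <= mu D)%E.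
Proof.
move=> + mF; elim: s D => [|i s IH] D mD us tF FD.
  by rewrite big_nil measure_ge0.
have FiD : F i `<=` D by apply: FD; rewrite mem_head.
have mDD : measurable (D `\` F i) by exact: measurableD.
rewrite big_cons -(setDUK FiD) measureU//; last first.
  by apply/seteqP; split => // x [? []].
rewrite leeD2l// IH//.
- by case/andP: us.
- by move=> j k x js ks; apply: tF; rewrite inE ?js ?ks orbT.
- move=> j js x Fx; split; first by apply: FD Fx; rewrite inE js orbT.
  move=> Fix; move: us => /= /andP[/negP + _]; apply.
  by rewrite (tF i j x)// ?mem_head// inE js orbT.
Qed.

End finite_cover.

(** * Averages of a BMO function over nested balls *)

Section bmo_balls.
Context {R : realType} {d : nat}.
Local Notation mu := (@lebesgueRd R d).
Local Notation V := (@ball_volume R d).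
Implicit Types (f g : lebRd R d -> R) (x y : 'rV[R]_d).

(** The mean minimises the square deviation, so an estimate around any convenient constant [a]
    bounds the oscillation. *)
Lemma oscillation_le g x (r a C : R) : 0 < r -> 0 <= C ->
  measurable_fun (eball x r) g ->
  (\int[mu]_(y in eball x r) ((g y - a) ^+ 2)%:E <= (V r * C ^+ 2)%:E)%E ->
  (oscillation (eball x r) g <= C%:E)%E.
Proof.
move=> r0 C0 mg gC; have Vr := ball_volume_gt0 d r0.
have muB := lebesgueRd_eball x r0.
have -> : C%:E = sqrte (C ^+ 2)%:E by rewrite /= sqrtr_sqr ger0_norm.
rewrite lee_sqrt ?lee_fin ?sqr_ge0//.
rewrite muB /= lee_pdivrMl// -EFinM.
under eq_integral do rewrite real_normK ?num_real//.
apply: le_trans gC; rewrite /avg muB/=.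
by apply: sqr_dev_mean_le => //; exact: measurable_eball.
Qed.

Lemma bmo_norm_ge0 f : (0 <= bmo_norm f)%E.
Proof.
apply: (@le_trans _ _ (oscillation (eball (0 : 'rV[R]_d) 1) f)).
  exact: sqrte_ge0.
by rewrite /bmo_norm; apply: ereal_sup_ubound; exists (0, 1) => /=.
Qed.

Variable f : lebRd R d -> R.
Hypothesis fBMO : BMO f.
Local Notation N := (fine (bmo_norm f)).

Lemma bmo_norm_fineK : (N%:E = bmo_norm f)%E.
Proof. by rewrite fineK// ge0_fin_numE ?bmo_norm_ge0//; exact: fBMO.2. Qed.

Lemma fine_bmo_norm_ge0 : 0 <= N.
Proof. by rewrite fine_ge0// bmo_norm_ge0. Qed.

Lemma measurable_BMO_eball x (r : R) : 0 < r -> measurable_fun (eball x r) f.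
Proof.
by move=> r0; have /integrableP[/measurable_EFinP] := fBMO.1 x r r0.
Qed.

Lemma ball_dev_le x (r : R) : 0 < r ->
  (\int[mu]_(y in eball x r) ((f y - avg (eball x r) f) ^+ 2)%:E
   <= (V r * N ^+ 2)%:E)%E.
Proof.
move=> r0; have Vr := ball_volume_gt0 d r0.
have : (oscillation (eball x r) f <= N%:E)%E.
  by rewrite bmo_norm_fineK /bmo_norm; apply: ereal_sup_ubound; exists (x, r).
have {1}-> : N%:E = sqrte (N ^+ 2)%:E.
  by rewrite /= sqrtr_sqr ger0_norm// fine_bmo_norm_ge0.
rewrite lee_sqrt ?lee_fin ?sqr_ge0//.
rewrite {1}(lebesgueRd_eball x r0)/= lee_pdivrMl// -EFinM.
by under eq_integral do rewrite real_normK ?num_real//.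
Qed.

Lemma ball_dev_mean x (r a : R) : 0 < r ->
  (\int[mu]_(y in eball x r) ((f y - a) ^+ 2)%:E < +oo)%E ->
  (\int[mu]_(y in eball x r) ((f y - a) ^+ 2)%:E
   = \int[mu]_(y in eball x r) ((f y - avg (eball x r) f) ^+ 2)%:E
     + (V r * (avg (eball x r) f - a) ^+ 2)%:E)%E.
Proof.
move=> r0 foo; rewrite /avg (lebesgueRd_eball x r0)/=.
apply: sqr_dev_mean => //; first exact: measurable_eball.
- exact: lebesgueRd_eball.
- exact: ball_volume_gt0.
- exact: measurable_BMO_eball.
Qed.

(** Integrate the square deviation from the larger ball's average. Over the smaller ball it is at
    most the integral over the larger one, and by [ball_dev_mean] it contains the left-hand side as
    its bias term. *)
Lemma avg_sub_eball x y (r s : R) : 0 < r -> 0 < s -> eball x r `<=` eball y s ->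
  V r * (avg (eball x r) f - avg (eball y s) f) ^+ 2 <= V s * N ^+ 2.
Proof.
move=> r0 s0 rs; set a := avg (eball y s) f.
have fa : (\int[mu]_(z in eball x r) ((f z - a) ^+ 2)%:E <= (V s * N ^+ 2)%:E)%E.
  apply: (le_trans _ (ball_dev_le y s0)).
  apply: (@ge0_subset_integral _ (lebRd R d) _ mu _ _
    (measurable_eball x r) (measurable_eball y s)).
  - by apply: measurable_sqr_dev; exact: measurable_BMO_eball.
  - by move=> z _; rewrite lee_fin sqr_ge0.
  - exact: rs.
rewrite -lee_fin; apply: (le_trans _ fa); rewrite ball_dev_mean//; last first.
  by rewrite (le_lt_trans fa)// ltry.
by rewrite leeDr// integral_ge0// => z _; rewrite lee_fin sqr_ge0.
Qed.

(** The volume ratio 2^d bounds the squared difference by 2^d N^2; weakening 2^d to its square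
    avoids a root. *)
Lemma avg_sub_eball_double x y (r : R) : 0 < r -> eball x r `<=` eball y (2 * r) ->
  `|avg (eball x r) f - avg (eball y (2 * r)) f| <= 2 ^+ d * N.
Proof.
move=> r0 r2; have Vr := ball_volume_gt0 d r0.
have := avg_sub_eball r0 (mulr_gt0 (ltr0Sn R 1) r0) r2.
rewrite ball_volumeM (mulrC (2 ^+ d)) -(mulrA (V r)) ler_pM2l// => h.
have N0 := fine_bmo_norm_ge0.
have p1 : (1 : R) <= 2 ^+ d by rewrite exprn_ege1// ler1n.
rewrite -(ler_pXn2r (n := 2))// ?nnegrE ?mulr_ge0 ?exprn_ge0//.
rewrite real_normK ?num_real// exprMn (le_trans h)// ler_wpM2r ?sqr_ge0//.
by rewrite expr2 ler_peMr// (le_trans ler01).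
Qed.

(** Telescoping over n doublings: the cost is linear in n, which is the source of the logarithm in
    the theorem. *)
Lemma avg_sub_eball_pow2 x (r : R) n : 0 < r ->
  `|avg (eball x r) f - avg (eball x (2 ^+ n * r)) f| <= n%:R * (2 ^+ d * N).
Proof.
move=> r0; elim: n => [|n IH]; first by rewrite expr0 mul1r subrr normr0 mul0r.
rewrite (le_trans (ler_distD (avg (eball x (2 ^+ n * r)) f) _ _))//.
rewrite -[n.+1%:R]natr1 mulrDl mul1r lerD// exprS -mulrA.
have p0 : 0 < 2 ^+ n * r by rewrite mulr_gt0// exprn_gt0.
apply: avg_sub_eball_double => //; apply: sub_eball.
by rewrite subrr enorm0; lra.
Qed.

End bmo_balls.

(** * Composition with a measure-preserving map: change of variables, Lipschitz bound and separated
    nets *)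

Section measure_preserving_comp.
Context {R : realType} {d : nat}.
Local Notation mu := (@lebesgueRd R d).
Local Notation V := (@ball_volume R d).
Variable phi : 'rV[R]_d -> 'rV[R]_d.
Hypothesis phi_mp : measure_preserving phi.

Lemma measurable_preimage (A : set (lebRd R d)) :
  measurable A -> measurable (phi @^-1` A : set (lebRd R d)).
Proof. by move=> mA; rewrite -[X in measurable X]setTI; exact: phi_mp.1. Qed.

(** The pushforward of [mu] by [phi] agrees with [mu] on measurable sets, so the integrals against
    the two measures coincide. *)
Lemma integral_measure_preserving (A : set (lebRd R d)) (h : lebRd R d -> \bar R) :
  measurable A -> measurable_fun A h -> (forall y, 0 <= h y)%E ->
  (\int[mu]_(x in phi @^-1` A) h (phi x) = \int[mu]_(y in A) h y)%E.
Proof.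
move=> mA mh h0.
have H := @ge0_integral_pushforward _ _ (lebRd R d) (lebRd R d) _
  phi phi_mp.1 mu A h mA mh.
rewrite -[LHS]H; last by move=> y _; exact: h0.
have E := @eq_measure_integral _ (lebRd R d) _ A mu
  (measure_pushforward mu phi_mp.1) h.
by apply: E => B mB _; exact: phi_mp.2.
Qed.

Variable M : R.
Hypothesis M0 : 0 < M.
Hypothesis phi_lip : forall x y, enorm (phi x - phi y) <= M * enorm (x - y).

Lemma eball_sub_preimage x (r : R) :
  eball x r `<=` (phi @^-1` eball (phi x) (M * r) : set (lebRd R d)).
Proof.
move=> y; rewrite /eball/= => yr; rewrite (le_lt_trans (phi_lip _ _))//.
by rewrite ltr_pM2l.
Qed.

Variable f : lebRd R d -> R.
Hypothesis fBMO : BMO f.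
Local Notation N := (fine (bmo_norm f)).

Lemma measurable_comp_eball x (r : R) : 0 < r ->
  measurable_fun (eball x r) (f \o phi : lebRd R d -> R).
Proof.
move=> r0.
have Mr : 0 < M * r by rewrite mulr_gt0.
apply: (@measurable_comp _ _ _ (lebRd R d) (lebRd R d) _ (eball (phi x) (M * r))).
- exact: measurable_eball.
- by move=> _ [y /eball_sub_preimage + <-]; exact.
- exact: measurable_BMO_eball.
- by apply: measurable_funTS; exact: phi_mp.1.
Qed.

(** Enlarge B(x, r) to the preimage of B(phi x, M r) and change variables. This is the estimate used
    for small distortion. *)
Lemma oscillation_comp_lip x (r : R) : 1 <= M -> 0 < r ->
  (oscillation (eball x r) (f \o phi : lebRd R d -> R) <= (M ^+ d * N)%:E)%E.
Proof.
move=> M1 r0; have Vr := ball_volume_gt0 d r0.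
have Mr : 0 < M * r by rewrite mulr_gt0.
have Md : 1 <= M ^+ d by rewrite exprn_ege1.
apply: (@oscillation_le _ _ _ _ _ (avg (eball (phi x) (M * r)) f)) => //.
- by rewrite mulr_ge0 ?fine_bmo_norm_ge0// exprn_ge0// ltW.
- exact: measurable_comp_eball.
set a := avg _ _.
have mE := measurable_eball (phi x) (M * r).
have mh : measurable_fun (eball (phi x) (M * r)) (fun y => ((f y - a) ^+ 2)%:E).
  by apply: measurable_sqr_dev; exact: measurable_BMO_eball.
apply: (@le_trans _ _ (\int[mu]_(y in phi @^-1` eball (phi x) (M * r))
   ((f (phi y) - a) ^+ 2)%:E)%E).
  apply: (@ge0_subset_integral _ (lebRd R d) _ mu _ _
    (measurable_eball x r) (measurable_preimage mE)).
  - apply: (@measurable_comp _ _ _ (lebRd R d) (lebRd R d) _ (eball (phi x) (M * r))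
      (fun y => ((f y - a) ^+ 2)%:E)) => //.
      by move=> _ [y + <-].
    by apply: measurable_funTS; exact: phi_mp.1.
  - by move=> z _; rewrite lee_fin sqr_ge0.
  - exact: eball_sub_preimage.
rewrite (integral_measure_preserving mE mh); last first.
  by move=> y; rewrite lee_fin sqr_ge0.
apply: (le_trans (ball_dev_le fBMO (phi x) Mr)).
rewrite lee_fin ball_volumeM exprMn (mulrC (M ^+ d)) -(mulrA (V r)).
rewrite ler_pM2l// ler_wpM2r ?sqr_ge0//.
by rewrite expr2 ler_peMr// (le_trans ler01).
Qed.

Hypothesis phi_expand : forall x y, enorm (x - y) <= M * enorm (phi x - phi y).

(** The points stay in the domain; it is their images that are kept apart. *)
Definition separated (rho : R) (s : seq 'rV[R]_d) :=
  forall p q, p \in s -> q \in s -> p <> q -> rho <= enorm (phi p - phi q).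

(** Packing: the balls of radius r/M about the images are disjoint, their preimages have the same
    volume, and [phi_expand] puts each preimage within r of its point, hence inside B(x, 2r). *)
Lemma separated_size x (r : R) (s : seq 'rV[R]_d) : 0 < r -> uniq s ->
  (forall p, p \in s -> eball x r p) -> separated (2 * (r / M)) s ->
  (size s)%:R * V (r / M) <= V (2 * r).
Proof.
move=> r0 us sx sep.
have rM : 0 < r / M by rewrite divr_gt0.
have r2 : 0 < 2 * r by rewrite mulr_gt0.
pose F p : set (lebRd R d) := phi @^-1` eball (phi p) (r / M).
have mF p : measurable (F p) by apply: measurable_preimage; exact: measurable_eball.
have : (\sum_(p <- s) mu (F p) <= mu (eball x (2 * r)))%E.
  apply: (@measure_disjoint_sum_le _ (lebRd R d) _ mu) => //.
  - exact: measurable_eball.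
  - move=> p q z ps qs; rewrite /F /eball/= => zp zq; apply/eqP/negPn/negP => /eqP pq.
    have := enorm_triangle (phi z) (phi p) (phi q).
    rewrite (enorm_distC (phi p) (phi z)); have := sep _ _ ps qs pq; lra.
  - move=> p ps z; rewrite /F /eball/= ltr_pdivlMr// mulrC => zp.
    have := enorm_triangle p z x; have := sx _ ps; rewrite /eball/= => px.
    by have := phi_expand z p; lra.
rewrite (eq_bigr (fun=> (V (r / M))%:E)); last first.
  by move=> p _; rewrite /F phi_mp.2 ?lebesgueRd_eball//; exact: measurable_eball.
rewrite lebesgueRd_eball// sumEFin lee_fin big_const_seq count_predT.
by rewrite iter_addr_0 -[V _ *+ _]mulr_natl.
Qed.

(** A separated family of largest size exists by the packing bound. A point whose image is left
    uncovered could be added to it, contradicting maximality. *)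
Lemma separated_net x (r : R) : 0 < r ->
  exists s : seq 'rV[R]_d, [/\ uniq s, forall p, p \in s -> eball x r p,
    separated (2 * (r / M)) s &
    forall y, eball x r y ->
      exists2 p, p \in s & eball (phi p) (2 * (r / M)) (phi y)].
Proof.
move=> r0.
have rM : 0 < r / M by rewrite divr_gt0.
have VrM := ball_volume_gt0 d rM.
pose P n := `[< exists s : seq 'rV[R]_d, [/\ size s = n, uniq s,
  forall p, p \in s -> eball x r p & separated (2 * (r / M)) s] >].
have P0 : exists n, P n by exists 0%N; apply/asboolP; exists [::].
pose B := Num.bound (V (2 * r) / V (r / M)).
have PB n : P n -> (n <= B)%N.
  move=> /asboolP[s [<- us sx sep]].
  have := separated_size r0 us sx sep.
  rewrite -ler_pdivlMr// => sB; rewrite -(ler_nat R) (le_trans sB)//.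
  by rewrite ltW// archi_boundP// divr_ge0// ltW// ball_volume_gt0// mulr_gt0.
have [n /asboolP[s [sn us sx sep]] nmax] := ex_maxnP P0 PB.
exists s; split => // y yx; apply/not_exists2P => no.
have far p : p \in s -> 2 * (r / M) <= enorm (phi y - phi p).
  by move=> ps; case: (no p) => // /negP; rewrite -leNgt.
suff /nmax : P n.+1 by rewrite ltnn.
apply/asboolP; exists (y :: s); split.
- by rewrite /= sn.
- rewrite /= us andbT; apply/negP => /far; rewrite subrr enorm0; lra.
- by move=> p; rewrite inE => /orP[/eqP ->//|/sx].
- move=> p q; rewrite !inE => /orP[/eqP ->|ps] /orP[/eqP ->|qs] // pq.
  + exact: far.
  + by rewrite enorm_distC; exact: far.
  + exact: sep.
Qed.

End measure_preserving_comp.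

(** * The covering estimate, with distortion bounded by a power of two *)

Section bilipschitz_comp.
Context {R : realType} {d : nat}.
Local Notation mu := (@lebesgueRd R d).
Local Notation V := (@ball_volume R d).
Variable phi : 'rV[R]_d -> 'rV[R]_d.
Hypothesis phi_mp : measure_preserving phi.
Variable m : nat.
Hypothesis phi_lip : forall x y, enorm (phi x - phi y) <= 2 ^+ m * enorm (x - y).
Hypothesis phi_expand :
  forall x y, enorm (x - y) <= 2 ^+ m * enorm (phi x - phi y).
Variable f : lebRd R d -> R.
Hypothesis fBMO : BMO f.
Local Notation N := (fine (bmo_norm f)).

(** About phi p, 2m doublings take the radius from 2r/2^m to 2 2^m r. Since phi p is within 2^m r of
    phi x, the resulting ball contains B(phi x, 2^m r), and one further comparison accounts for the
    successor. *)
Lemma avg_net_le x p (r : R) : 0 < r -> eball x r p ->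
  `|avg (eball (phi p) (2 * (r / 2 ^+ m))) f - avg (eball (phi x) (2 ^+ m * r)) f|
  <= (2 * m)%N.+1%:R * (2 ^+ d * N).
Proof.
move=> r0 xp; have M0 : 0 < (2 : R) ^+ m by rewrite exprn_gt0.
have rho0 : 0 < 2 * (r / 2 ^+ m) by rewrite mulr_gt0// divr_gt0.
have Mr : 0 < 2 ^+ m * r by rewrite mulr_gt0.
have rhoE : 2 ^+ (2 * m) * (2 * (r / 2 ^+ m)) = 2 * (2 ^+ m * r).
  by rewrite mul2n -addnn exprD; field; rewrite gt_eqF.
have h1 := avg_sub_eball_pow2 fBMO (phi p) (2 * m) rho0.
have h2 : `|avg (eball (phi x) (2 ^+ m * r)) f
    - avg (eball (phi p) (2 * (2 ^+ m * r))) f| <= 2 ^+ d * N.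
  apply: avg_sub_eball_double => //; apply: sub_eball.
  have := phi_lip x p; rewrite (enorm_distC x p).
  have : 2 ^+ m * enorm (p - x) <= 2 ^+ m * r by rewrite ler_pM2l// ltW.
  lra.
rewrite rhoE in h1.
rewrite (le_trans (ler_distD (avg (eball (phi p) (2 * (2 ^+ m * r))) f) _ _))//.
rewrite -[(2 * m)%N.+1%:R]natr1 [leRHS]mulrDl [1 * _]mul1r lerD//.
by rewrite distrC.
Qed.

Lemma oscillation_comp_pow2 x (r : R) : 0 < r ->
  (oscillation (eball x r) (f \o phi : lebRd R d -> R)
   <= (4 ^+ d * (2 * m + 2)%:R * N)%:E)%E.
Proof.
move=> r0; have M0 : 0 < (2 : R) ^+ m by rewrite exprn_gt0.
have N0 := fine_bmo_norm_ge0 f.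
have rM : 0 < r / 2 ^+ m by rewrite divr_gt0.
pose rho : R := 2 * (r / 2 ^+ m).
have rho0 : 0 < rho by rewrite mulr_gt0.
have Vr := ball_volume_gt0 d r0.
have Vrho := ball_volume_gt0 d rho0.
have [s [us sx sep cov]] := separated_net phi_mp M0 phi_expand x r0.
have size_s := separated_size phi_mp M0 phi_expand r0 us sx sep.
pose a := avg (eball (phi x) (2 ^+ m * r)) f.
apply: (@oscillation_le _ _ _ _ _ a) => //.
- by rewrite !mulr_ge0// exprn_ge0.
- exact: (measurable_comp_eball phi_mp M0 phi_lip fBMO).
(* By [avg_net_le], c N bounds the distance from the average over any ball of the cover to [a]. *)
pose c : R := (2 * m)%N.+1%:R * 2 ^+ d.
have mB p := measurable_eball (phi p) rho.
have mh p : measurable_fun (eball (phi p) rho) (fun y => ((f y - a) ^+ 2)%:E).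
  by apply: measurable_sqr_dev; exact: measurable_BMO_eball.
(* On each ball of the cover the variance contributes N^2 and the bias (c N)^2, per unit volume. *)
have dev p : p \in s -> (\int[mu]_(y in eball (phi p) rho) ((f y - a) ^+ 2)%:E
    <= (V rho * ((1 + c ^+ 2) * N ^+ 2))%:E)%E.
  move=> ps; rewrite (ball_dev_mean fBMO rho0); last first.
    have muoo : (mu (eball (phi p) rho) < +oo)%E by rewrite lebesgueRd_eball// ltry.
    have := le_lt_trans (ball_dev_le fBMO (phi p) rho0) (ltry _).
    exact: (@sqr_dev_lty _ (lebRd R d) _ mu _ _ _ _ (mB p) muoo
      (measurable_BMO_eball fBMO rho0)).
  apply: (@le_trans _ _ ((V rho * N ^+ 2)%:E + (V rho * (c * N) ^+ 2)%:E)%E).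
    rewrite leeD// ?ball_dev_le// lee_fin ler_pM2l//.
    rewrite -real_normK ?num_real// ler_pXn2r// ?nnegrE ?mulr_ge0 ?exprn_ge0//.
    by rewrite -mulrA; apply: avg_net_le => //; exact: sx.
  by rewrite -EFinD lee_fin exprMn; lra.
apply: (@le_trans _ _ (\sum_(p <- s) \int[mu]_(y in phi @^-1` eball (phi p) rho)
   ((f (phi y) - a) ^+ 2)%:E)%E).
  apply: (@ge0_integral_cover_le _ (lebRd R d) _ mu _ s
    (fun p => phi @^-1` eball (phi p) rho)).
  - exact: measurable_eball.
  - by move=> p; apply: measurable_preimage => //; exact: mB.
  - move=> p ps.
    apply: (@measurable_comp _ _ _ (lebRd R d) (lebRd R d) _ (eball (phi p) rho)
      (fun y => ((f y - a) ^+ 2)%:E)) => //.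
    + by move=> _ [y + <-].
    + by apply: measurable_funTS; exact: phi_mp.1.
  - by move=> y; rewrite lee_fin sqr_ge0.
  - apply: measurable_sqr_dev.
    exact: (measurable_comp_eball phi_mp M0 phi_lip fBMO).
  - exact: cov.
apply: (@le_trans _ _ (\sum_(p <- s) (V rho * ((1 + c ^+ 2) * N ^+ 2))%:E)%E).
  rewrite big_seq [leRHS]big_seq; apply: lee_sum => p ps.
  rewrite (integral_measure_preserving phi_mp (mB p) (mh p)); first exact: dev.
  by move=> y; rewrite lee_fin sqr_ge0.
rewrite sumEFin lee_fin big_const_seq count_predT iter_addr_0.
rewrite -[_ *+ size s]mulr_natl [leLHS]mulrA.
(* One factor 2^d comes from doubling r/M to [rho], the other from the ball of radius 2r in the
   packing bound. *)
have sV : (size s)%:R * V rho <= 4 ^+ d * V r.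
  rewrite /rho ball_volumeM mulrCA.
  have -> : 4 ^+ d * V r = 2 ^+ d * V (2 * r).
    by rewrite ball_volumeM mulrA -exprMn -natrM.
  by rewrite ler_pM2l// exprn_gt0.
rewrite (le_trans (ler_wpM2r _ sV))// ?mulr_ge0 ?sqr_ge0 ?addr_ge0 ?sqr_ge0//.
have -> : 4 ^+ d * V r * ((1 + c ^+ 2) * N ^+ 2)
    = V r * (4 ^+ d * (1 + c ^+ 2) * N ^+ 2) by ring.
rewrite ler_pM2l// [leRHS]exprMn ler_wpM2r ?sqr_ge0//.
have D1 : (1 : R) <= 2 ^+ d by rewrite exprn_ege1// ler1n.
have -> : (4 : R) ^+ d = 2 ^+ d * 2 ^+ d by rewrite -exprMn -natrM.
rewrite /c; set D : R := 2 ^+ d in D1 *.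
have -> : (2 * m).+1%:R = 2 * m%:R + 1 :> R by rewrite -natr1 natrM.
have -> : (2 * m + 2)%:R = 2 * m%:R + 2 :> R by rewrite natrD natrM.
have : (0 : R) <= m%:R by [].
move: (m%:R : R) => k k0.
(* After cancelling D^2 = 4^d, the claim is 1 + (2k+1)^2 D^2 <= D^2 (2k+2)^2, and the two squares
   differ by 4k + 3. *)
have -> : (D * D * (2 * k + 2)) ^+ 2 = D * D * (D * D * (2 * k + 2) ^+ 2) by ring.
have DD : 1 <= D * D by rewrite mulr_ege1.
rewrite ler_pM2l ?(lt_le_trans ltr01)//.
suff : 1 <= D * D * (4 * k + 3) by rewrite !expr2; lra.
by rewrite mulr_ege1//; lra.
Qed.

End bilipschitz_comp.

(** * The constant K as a two-sided Lipschitz bound, in positive dimension *)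

Section bilip_const.
Context {R : realType} {d : nat}.
Variable phi : 'rV[R]_d.+1 -> 'rV[R]_d.+1.
Hypothesis phi_bilip : bilipschitz phi.
Local Notation K := (bilip_const phi).

Let ratio (p : 'rV[R]_d.+1 * 'rV[R]_d.+1) : R :=
  Num.max (enorm (phi p.1 - phi p.2) / enorm (p.1 - p.2))
          (enorm (p.1 - p.2) / enorm (phi p.1 - phi p.2)).

Lemma enorm_gt0 (x : 'rV[R]_d.+1) : x != 0 -> 0 < enorm x.
Proof.
move=> x0; rewrite lt_neqAle enorm_ge0 andbT eq_sym.
by apply: contra x0 => /eqP/enorm0_eq0 ->.
Qed.

Lemma bilip_enorm_gt0 x y : x != y -> 0 < enorm (x - y) /\ 0 < enorm (phi x - phi y).
Proof.
move=> xy; have xy0 : 0 < enorm (x - y) by rewrite enorm_gt0// subr_eq0.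
split=> //; have [L L0 /(_ x y)/andP[+ _]] := phi_bilip.
by apply: lt_le_trans; rewrite mulr_gt0// invr_gt0.
Qed.

Lemma bilip_ratio_le x y : x != y -> ratio (x, y) <= K.
Proof.
move=> xy; apply: sup_upper_bound; last by exists (x, y).
split; first by exists (ratio (x, y)), (x, y).
(* Any bi-Lipschitz constant [L] bounds all the ratios, so the real supremum is a genuine upper
   bound. *)
have [L L0 Llip] := phi_bilip; exists L => _ [[p q]/= pq <-].
have [pq0 ppq0] := bilip_enorm_gt0 pq; have /andP[lo hi] := Llip p q.
rewrite ge_max !ler_pdivrMr// hi/=.
by rewrite -ler_pdivrMl.
Qed.

Lemma bilip_const_lip x y : enorm (phi x - phi y) <= K * enorm (x - y).
Proof.
have [->|xy] := eqVneq x y; first by rewrite !subrr !enorm0 mulr0.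
have [xy0 _] := bilip_enorm_gt0 xy.
by rewrite -ler_pdivrMr// (le_trans _ (bilip_ratio_le xy))// le_max lexx.
Qed.

Lemma bilip_const_expand x y : enorm (x - y) <= K * enorm (phi x - phi y).
Proof.
have [->|xy] := eqVneq x y; first by rewrite !subrr !enorm0 mulr0.
have [_ xy0] := bilip_enorm_gt0 xy.
by rewrite -ler_pdivrMr// (le_trans _ (bilip_ratio_le xy))// le_max lexx orbT.
Qed.

(** Positive dimension supplies two distinct points; K < 1 would make their distance and that of
    their images each smaller than the other. *)
Lemma bilip_const_ge1 : 1 <= K.
Proof.
have xy : (0 : 'rV[R]_d.+1) != const_mx 1.
  by apply/eqP => /rowP/(_ ord0)/eqP; rewrite !mxE eq_sym oner_eq0.
have [xy0 pxy0] := bilip_enorm_gt0 xy.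
have := bilip_const_lip 0 (const_mx 1); have := bilip_const_expand 0 (const_mx 1).
set a := enorm _; set b := enorm _ => ab ba; rewrite leNgt; apply/negP => K1.
have : a < b by rewrite (le_lt_trans ab)// gtr_pMl.
by rewrite ltNge (le_trans ba)// ger_pMl// ltW.
Qed.

End bilip_const.

(** * Choice of the constant and the two ranges of K *)

Theorem theorem1p8 (R : realType) (d : nat) :
  exists c : R,
    forall (f : lebRd R d -> R) (phi : 'rV[R]_d -> 'rV[R]_d),
      BMO f ->
      homeomorphism phi -> bilipschitz phi -> measure_preserving phi ->
      (bmo_norm (f \o phi) <= bmo_norm f * (1 + c * ln (bilip_const phi))%:E)%E.
Proof.
case: d => [|d].
  (* In dimension 0 the space is a single point, so f o phi = f. *)
  exists 0 => f phi _ _ _ _; rewrite mul0r addr0 mule1.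
  by rewrite (_ : f \o phi = f)//; apply/funext => x /=; rewrite !thinmx0.
have ln2 : (0 : R) < ln 2 by rewrite ln_gt0// ltr1n.
(* [c1] serves K < 2, and [c2] serves K >= 2; both are nonnegative, so their sum serves both
   ranges. *)
pose c1 : R := d.+1%:R * 2 ^+ d.+1.
pose c2 : R := 4 ^+ d.+1 * 8 / ln 2.
have c10 : 0 <= c1 by rewrite mulr_ge0// exprn_ge0.
have c20 : 0 <= c2 by rewrite divr_ge0 ?mulr_ge0 ?exprn_ge0// ltW.
exists (c1 + c2) => f phi fBMO _ phi_bilip phi_mp.
have K1 := bilip_const_ge1 phi_bilip.
have lip := bilip_const_lip phi_bilip; have expand := bilip_const_expand phi_bilip.
move: (bilip_const phi) K1 lip expand => K K1 lip expand.
have K0 : 0 < K by rewrite (lt_le_trans ltr01).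
have lnK0 : 0 <= ln K by rewrite ln_ge0.
have N0 := fine_bmo_norm_ge0 f.
rewrite -(bmo_norm_fineK fBMO) -EFinM.
apply: ub_ereal_sup => _ [[x r]/= r0 <-].
have [K2|K2] := ltP K 2.
  apply: (le_trans (oscillation_comp_lip phi_mp K0 lip fBMO x K1 r0)).
  rewrite lee_fin mulrC ler_wpM2l//.
  apply: (@le_trans _ _ (1 + c1 * ln K)); last first.
    by rewrite lerD2l ler_wpM2r// lerDl.
  pose t := d.+1%:R * ln K.
  have Kt : K ^+ d.+1 = expR t by rewrite /t mulrC expRM_natr lnK.
  (* Multiplied by e^t this gives e^t <= 1 + t e^t, and e^t = K^d is at most 2^d here, with d the
     full dimension. *)
  have : 1 - t <= expR (- t) by exact: expR_ge1Dx.
  rewrite expRN -(ler_pM2l (expR_gt0 t)) mulfV ?gt_eqF ?expR_gt0// => h.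
  have t0 : 0 <= t by rewrite mulr_ge0.
  have : expR t * t <= 2 ^+ d.+1 * t.
    by rewrite ler_wpM2r// -Kt lerXn2r// ?nnegrE// ?ltW.
  by rewrite Kt /c1 /t in h *; lra.
(* Take the least m with K <= 2^m. Then (m - 1) ln 2 <= ln K by minimality, and ln 2 <= ln K since K
   >= 2; adding gives the factor 2. *)
have [m [m1 Km mK]] : exists m, [/\ (0 < m)%N, K <= 2 ^+ m & m%:R * ln 2 <= 2 * ln K].
  have exK : exists n, K <= 2 ^+ n.
    exists (Num.bound K); rewrite ltW// (lt_trans (archi_boundP (ltW K0)))//.
    by rewrite -natrX ltr_nat ltn_expl.
  case: (ex_minnP exK) => -[|n] Kn nmin; first by move: Kn; rewrite expr0; lra.
  exists n.+1; split => //.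
  have nK : 2 ^+ n < K by rewrite ltNge; apply/negP => /nmin; rewrite ltnn.
  have : ln (2 ^+ n) <= ln K by rewrite ler_ln ?posrE ?exprn_gt0// ltW.
  have : ln 2 <= ln K by rewrite ler_ln ?posrE.
  by rewrite lnXn// -[ln 2 *+ n]mulr_natl -[n.+1%:R]natr1; lra.
apply: (@le_trans _ _ (4 ^+ d.+1 * (2 * m + 2)%:R * fine (bmo_norm f))%:E).
  apply: oscillation_comp_pow2 => // y z.
  - by rewrite (le_trans (lip y z))// ler_wpM2r// enorm_ge0.
  - by rewrite (le_trans (expand y z))// ler_wpM2r// enorm_ge0.
rewrite lee_fin mulrC ler_wpM2l//.
apply: (@le_trans _ _ (c2 * ln K)); last first.
  rewrite [(c1 + c2) * _]mulrDl addrA lerDr.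
  by rewrite addr_ge0// mulr_ge0.
have -> : c2 * ln K = 4 ^+ d.+1 * (4 * (2 * ln K / ln 2)).
  by rewrite /c2; field; rewrite gt_eqF.
rewrite ler_pM2l ?exprn_gt0//.
(* Since m >= 1, 2m + 2 <= 4m; together with m <= 2 ln K / ln 2 this yields the 8 / ln 2 in [c2]. *)
apply: (@le_trans _ _ (4 * m%:R)); last by rewrite ler_pM2l// ler_pdivlMr.
have : (1 : R) <= m%:R by rewrite ler1n.
by rewrite natrD natrM; lra.
Qed.
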